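(* Let $m\in\mathbb N$, and for $k=1,\dots,m$ let $a_k,h_k:[0,\infty)\to\mathbb R$ satisfy $a_k(t)\ge 0$ and $h_k(t)\le t$ for all $t\ge 0$. Put $$g_k(t)=\sup_{s\le t}h_k(s),\quad k=1,\dots,m,\qquad g(t)=\max_{1\le k\le m}g_k(t),$$ and for real $s\le t$ let $$\mathcal N(s,t)=\{\,s+j : j=0,1,2,\dots,\ s+j\le t-1\,\}.$$ Let $$\limsup_{t\to\infty}\ \sum_{u\in\mathcal N(g(t),t)}\ \sum_{k=1}^m a_k(u)\prod_{r\in\mathcal N(h_k(u),\,g(t))}\Big(1-\sum_{i=1}^m a_i(r)\Big)>1 .$$ Then the equation $$x(t+1)-x(t)+\sum_{k=1}^m a_k(t)\,x(h_k(t))=0,\qquad t\ge 0,$$ has no positive non-increasing solutions (and no negative non-decreasing solutions).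
   Context: A solution is a function $x:\mathbb R\to\mathbb R$ satisfying the equation for all $t\ge 0$ (values on $(-\infty,1)$ are initial data; no regularity is required). It is positive non-increasing if $x(t)>0$ for all $t$ and $x$ is non-increasing; negative non-decreasing is defined analogously. The supremum defining $g_k(t)$ is over those $s\le t$ at which $h_k$ is defined. Empty sums equal $0$ and empty products equal $1$. *)

(* Defs.v *)
From HB Require Import structures.
From mathcomp Require Import all_boot all_order all_algebra.
From mathcomp Require Import all_classical all_reals all_analysis.
Set Implicit Arguments.
Unset Strict Implicit.
Unset Printing Implicit Defensive.
Import Order.TTheory GRing.Theory Num.Theory numFieldNormedType.Exports.
Local Open Scope classical_set_scope.
Local Open Scope ring_scope.

(* The number of delays is m.+1 (at least one), with delays indexed by
   'I_m.+1.  The coefficients and delays are functions on [0, +oo[; they are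
   represented by total functions R -> R whose values at negative arguments
   are never used. *)

(* sup is a genuine supremum for t >= 0, as the set is then nonempty and
   bounded above by t whenever hk s <= s for all s >= 0. *)
Definition gsup (R : realType) (hk : R -> R) (t : R) : R :=
  sup [set hk s | s in `[0, t]].

Definition gmax (R : realType) (m : nat) (h : 'I_m.+1 -> R -> R) (t : R) : R :=
  \big[Num.max/gsup (h ord0) t]_(k < m.+1) gsup (h k) t.

Definition steps (R : realType) (s t : R) : set R :=
  [set s + j%:R | j in [set j : nat | s + j%:R <= t - 1]].

(* Big operators over a classical set return the neutral element when the
   support is infinite; that never happens for steps s t. *)
Lemma finite_steps (R : realType) (s t : R) : finite_set (steps s t).
Proof.
apply: finite_image; apply: (sub_finite_set _ (finite_II (Num.bound (t - 1 - s)))).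
move=> j /= hj; rewrite -(ltr_nat R).
have jle : j%:R <= t - 1 - s by rewrite lerBrDl.
exact: le_lt_trans jle (archi_boundP (le_trans (ler0n R j) jle)).
Qed.

(* The indices u and r run over the points of steps at which the coefficients
   are defined, i.e., the nonnegative ones. *)
Definition oscillation_sum (R : realType) (m : nat) (a h : 'I_m.+1 -> R -> R)
    (t : R) : R :=
  \sum_(u \in steps (gmax h t) t `&` `[0, +oo[)
    \sum_(k < m.+1)
      a k u * \big[*%R/1]_(r \in steps (h k u) (gmax h t) `&` `[0, +oo[)
                (1 - \sum_(i < m.+1) a i r).

Definition is_solution (R : realType) (m : nat) (a h : 'I_m.+1 -> R -> R)
    (x : R -> R) : Prop :=
  forall t, 0 <= t -> x (t + 1) - x t + \sum_(k < m.+1) a k t * x (h k t) = 0.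

(* Main.v *)
(** A positive non-increasing solution satisfies [x (h k t) >= x t], whence
    [x (t + 1) <= (1 - \sum_i a i t) x t]: the factors of the products lie in
    [0, 1], so the products may be dropped.  Since moreover
    [x (h k u) >= x (g t)] for [u <= t], summing the equation over the points
    [u] of [N(g t, t)] gives [x (g t) \sum_u \sum_k a k u <= x (g t)]. *)
Require Import Defs.
From HB Require Import structures.
From mathcomp Require Import all_boot all_order all_algebra.
From mathcomp Require Import all_classical all_reals all_analysis.
Import Order.TTheory GRing.Theory Num.Theory numFieldNormedType.Exports.
Local Open Scope classical_set_scope.
Local Open Scope ring_scope.

(** [limf_esup] is an infimum of suprema over the sets in [F], and the whole space is one of these
    sets. *)
Lemma limf_esup_le (T : choiceType) (X : filteredType T) (R : realType)
  (f : X -> \bar R) (F : set (set X)) (c : \bar R) :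
  F setT -> (forall t, (f t <= c)%E) -> (limf_esup f F <= c)%E.
Proof.
move=> FT fc; apply: ge_ereal_inf; exists (ereal_sup (range f)); first by exists setT.
by apply: ge_ereal_sup => _ [t _ <-]; exact: fc.
Qed.

Lemma ler_fsum (R : numDomainType) (T : choiceType) (A : set T) (F G : T -> R) :
  finite_set A -> (forall u, A u -> F u <= G u) ->
  \sum_(u \in A) F u <= \sum_(u \in A) G u.
Proof.
move=> finA FG; rewrite !fsbig_finite//= big_seq [leRHS]big_seq.
by apply: ler_sum => u; rewrite in_fset_set// inE => /FG.
Qed.

Lemma fprod_ile1 (R : numDomainType) (T : choiceType) (A : set T) (F : T -> R) :
  finite_set A -> (forall u, A u -> 0 <= F u <= 1) ->
  0 <= \big[*%R/1]_(u \in A) F u <= 1.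
Proof.
move=> finA F01; rewrite fsbig_finite//= big_seq.
apply: (big_ind (fun y => 0 <= y <= 1)) => [|y z /andP[y0 y1] /andP[z0 z1]|u].
- by rewrite ler01 lexx.
- by rewrite mulr_ge0// mulr_ile1.
- by rewrite in_fset_set// inE => /F01.
Qed.

(** All decrements are nonnegative, so the sum may be enlarged to all [s + j] with [j < N], where it
    telescopes to [x s - x (s + N)]. *)
Lemma sum_steps_telescope (R : realType) (x : R -> R) (s t : R) (B : set R) :
  (forall u, 0 < x u) -> (forall u v, u <= v -> x v <= x u) ->
  \sum_(u \in steps s t `&` B) (x u - x (u + 1)) <= x s.
Proof.
move=> xpos xni.
have d0 u : 0 <= x u - x (u + 1) by rewrite subr_ge0 xni// lerDl.
set D := [set j : nat | s + j%:R <= t - 1].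
have [N DN] : exists N, D `<=` `I_N.
  exists (Num.bound (t - 1 - s)) => j; rewrite /D/= => hj.
  have jle : j%:R <= t - 1 - s by rewrite lerBrDl.
  rewrite -(ltr_nat R).
  exact: le_lt_trans jle (archi_boundP (le_trans (ler0n R j) jle)).
(* Membership in [B] becomes a conditional term, leaving a sum over the image of the injective map
   sending [j] to [s + j]. *)
rewrite fsbig_mkcondr fsbig_image; last first.
  by move=> i j _ _ /addrI/eqP; rewrite eqr_nat => /eqP.
rewrite -/D -(setIidr DN) fsbig_mkcondr -fsbig_ord.
apply: (@le_trans _ _ (\sum_(j < N) (x (s + j%:R) - x (s + j.+1%:R)))).
  by apply: ler_sum => j _; rewrite -natr1 addrA; do 2?case: ifP.
rewrite -(big_mkord xpredT (fun j : nat => x (s + j%:R) - x (s + j.+1%:R))).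
under eq_bigr do rewrite -opprB.
by rewrite sumrN telescope_sumr// opprB addr0 gerBl ltW.
Qed.

(** On [[0, t]] the delay is bounded by [t], so [gsup] is a true supremum there. For a
    non-increasing [x] this yields [x (gmax h t) <= x (h k u)]. *)
Lemma delay_le_gmax (R : realType) (m : nat) (h : 'I_m.+1 -> R -> R) k u t :
  (forall k t, 0 <= t -> h k t <= t) -> 0 <= u -> u <= t -> h k u <= gmax h t.
Proof.
move=> h_le u0 ut; apply: (le_trans _ (le_bigmax _ (fun k => gsup (h k) t) k)).
apply: ub_le_sup; last by exists u; rewrite //= in_itv/= u0.
exists t => _ [v /itvP vt <-].
by rewrite (le_trans (h_le _ _ _)) ?vt.
Qed.

Lemma oscillation_sum_le1 (R : realType) (m : nat) (a h : 'I_m.+1 -> R -> R)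
  (x : R -> R) (t : R) :
  (forall k t, 0 <= t -> 0 <= a k t) -> (forall k t, 0 <= t -> h k t <= t) ->
  is_solution a h x -> (forall u, 0 < x u) ->
  (forall u v, u <= v -> x v <= x u) ->
  oscillation_sum a h t <= 1.
Proof.
move=> a_ge0 h_le xsol xpos xni.
have xE u : 0 <= u -> x u - x (u + 1) = \sum_(k < m.+1) a k u * x (h k u).
  by move=> /xsol/eqP; rewrite addrC addr_eq0 opprB => /eqP.
have factor01 r : 0 <= r -> 0 <= 1 - \sum_(i < m.+1) a i r <= 1.
  move=> r0; rewrite gerBl sumr_ge0 ?andbT; last by move=> i _; exact: a_ge0.
  (* After scaling by [x r], the coefficient sum is at most the decrement [x r - x (r + 1)], which
     is below [x r] because [x (r + 1)] is positive. *)
  rewrite subr_ge0 -(ler_pM2r (xpos r)) mul1r mulr_suml.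
  apply: (@le_trans _ _ (x r - x (r + 1))); last by rewrite gerBl ltW.
  rewrite xE//; apply: ler_sum => i _.
  by rewrite ler_wpM2l ?a_ge0// xni// h_le.
(* Scaling by [x (gmax h t)] allows a termwise comparison with the decrements of [x], whose sum
   telescopes. *)
rewrite -(ler_pM2l (xpos (gmax h t))) mulr1.
apply: le_trans (sum_steps_telescope _ x (gmax h t) t `[0, +oo[ xpos xni).
have fin (s v : R) : finite_set (steps s v `&` `[0, +oo[).
  by apply: finite_setIl; exact: finite_steps.
rewrite /oscillation_sum mulr_fsumr; apply: ler_fsum => // _ [[j /= ut <-]].
rewrite in_itv/= andbT => u0.
rewrite xE// mulr_sumr; apply: ler_sum => k _.
rewrite mulrCA ler_wpM2l ?a_ge0//.
set P := \big[_/_]_(_ \in _) _; have /andP[_ P1] : 0 <= P <= 1.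
  by apply: fprod_ile1 => // r [_]; rewrite /= in_itv/= andbT; exact: factor01.
(* The product [P] is dropped first; then monotonicity of [x] applies, as [u <= t - 1 <= t]. *)
apply: (@le_trans _ _ (x (gmax h t))); first by rewrite ger_pMr.
by apply/xni/delay_le_gmax => //; rewrite (le_trans ut)// gerBl.
Qed.

Theorem theorem5 (R : realType) (m : nat) (a h : 'I_m.+1 -> R -> R)
  (a_ge0 : forall k t, 0 <= t -> 0 <= a k t)
  (h_le : forall k t, 0 <= t -> h k t <= t)
  (limsup_gt1 :
    (1 < limf_esup (fun t : R => (oscillation_sum a h t)%:E) (pinfty_nbhs R))%E) :
  (~ exists x : R -> R,
      [/\ is_solution a h x,
          forall t, 0 < x t
        & forall s t, s <= t -> x t <= x s]) /\
  (~ exists x : R -> R,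
      [/\ is_solution a h x,
          forall t, x t < 0
        & forall s t, s <= t -> x s <= x t]).
Proof.
have nopos x : is_solution a h x -> (forall t, 0 < x t) ->
    (forall s t, s <= t -> x t <= x s) -> False.
  move=> xsol xpos xni; move: limsup_gt1; rewrite ltNge => /negP; apply.
  apply: limf_esup_le; first exact: filterT.
  by move=> t; rewrite lee_fin; exact: oscillation_sum_le1 a_ge0 h_le xsol xpos xni.
split=> [[x [xsol xpos xni]]|[x [xsol xneg xnd]]]; first exact: nopos xsol xpos xni.
apply: (nopos (fun t => - x t)) => [t t0|t|s t st]; last 2 first.
- by rewrite oppr_gt0.
- by rewrite lerN2 xnd.
(* The equation is linear and homogeneous, so [- x] solves it too. *)
under eq_bigr do rewrite mulrN.
by rewrite sumrN -!opprD xsol// oppr0.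
Qed.
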